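(* For every integer $m\geq 0$, $$\sum_{\iota\in F\mathcal{I}_{2m}(132)} q^{\mathrm{coinv}(\iota)} \;=\; \sum_{\iota\in F\mathcal{I}_{2m}(213)} q^{\mathrm{coinv}(\iota)} \;=\; C_m(q^2),$$ where $C_0(q)=1$ and $C_n(q)=\sum_{k=0}^{n-1} q^k C_k(q)C_{n-k-1}(q)$ for $n\geq 1$.
   Context: Permutations of $[n]$ are written in one-line notation. A permutation $\sigma\in\mathfrak{S}_n$ contains a pattern $\pi\in\mathfrak{S}_k$ if there are indices $m_1<\dots<m_k$ such that $\sigma(m_1)\cdots\sigma(m_k)$ is in the same relative order as $\pi$; otherwise it avoids $\pi$. An involution is a permutation $\iota$ with $\iota^2=\mathrm{id}$; it is fixed-point-free if $\iota(i)\neq i$ for all $i$. $F\mathcal{I}_{n}(\pi)$ is the set of fixed-point-free involutions of $[n]$ avoiding $\pi$ ($F\mathcal{I}_0(\pi)$ consists of the empty permutation). A coinversion of $\sigma$ is a pair $i<j$ with $\sigma(i)<\sigma(j)$, and $\mathrm{coinv}(\sigma)$ is the number of coinversions. *)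

(* Defs.v *)
From HB Require Import structures.
From mathcomp Require Import all_boot all_order all_algebra all_fingroup.

Set Implicit Arguments.
Unset Strict Implicit.
Unset Printing Implicit Defensive.

Import GRing.Theory.
Local Open Scope ring_scope.

(* Permutations of [n] are elements of 'S_n, so positions and values are
   0-based; one-line notation is recovered by shifting values by one. *)
Definition one_line n (s : 'S_n) : seq nat := [seq (val (s i)).+1 | i <- enum 'I_n].

Definition contains_pattern n k (s : 'S_n) (p : 'S_k) : bool :=
  [exists m : {ffun 'I_k -> 'I_n},
    [forall i : 'I_k, forall j : 'I_k, (i < j)%N ==> (m i < m j)%N] &&
    [forall i : 'I_k, forall j : 'I_k, (s (m i) < s (m j))%N == (p i < p j)%N]].

Definition avoids_pattern n k (s : 'S_n) (p : 'S_k) : bool :=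
  ~~ contains_pattern s p.

Definition p132 : 'S_3 := tperm (inord 1) (inord 2).
Definition p213 : 'S_3 := tperm (inord 0) (inord 1).

Lemma one_line_p132 : one_line p132 = [:: 1; 3; 2]%N.
Proof.
by rewrite /one_line !enum_ordSl (size0nil (size_enum_ord 0)) /= /p132 !permE /= -!val_eqE /=
  !inordK //= !inordK.
Qed.

Lemma one_line_p213 : one_line p213 = [:: 2; 1; 3]%N.
Proof.
by rewrite /one_line !enum_ordSl (size0nil (size_enum_ord 0)) /= /p213 !permE /= -!val_eqE /=
  !inordK //= !inordK.
Qed.

Definition is_involution n (s : 'S_n) : bool := (s * s == 1)%g.

Definition fixed_point_free n (s : 'S_n) : bool := [forall i, s i != i].

Definition FI n k (p : 'S_k) : {set 'S_n} :=
  [set s : 'S_n | [&& is_involution s, fixed_point_free s & avoids_pattern s p]].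

Definition coinv n (s : 'S_n) : nat :=
  #|[set ij : 'I_n * 'I_n | (ij.1 < ij.2)%N && (s ij.1 < s ij.2)%N]|.

(* qcatalan_seq n = [:: C_0(q); ...; C_n(q)]: each step appends the value given
   by the recurrence, which refers to all the previous ones. *)
Fixpoint qcatalan_seq (n : nat) : seq {poly int} :=
  if n is n'.+1 then
    let s := qcatalan_seq n' in
    rcons s (\sum_(k < n) 'X^k * s`_k * s`_(n - k - 1))
  else [:: 1].

Definition qcatalan (n : nat) : {poly int} := (qcatalan_seq n)`_n.

Lemma size_qcatalan_seq n : size (qcatalan_seq n) = n.+1.
Proof. by elim: n => //= n IHn; rewrite size_rcons IHn. Qed.

Lemma nth_qcatalan_seq n k : (k <= n)%N -> (qcatalan_seq n)`_k = qcatalan k.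
Proof.
elim: n => [|n IHn]; first by case: k.
rewrite leq_eqVlt => /orP[/eqP-> //|lt_kn].
by rewrite /= nth_rcons size_qcatalan_seq lt_kn IHn.
Qed.

Lemma qcatalan0 : qcatalan 0 = 1.
Proof. by []. Qed.

Lemma qcatalan_rec n : (1 <= n)%N ->
  qcatalan n = \sum_(k < n) 'X^k * qcatalan k * qcatalan (n - k - 1).
Proof.
case: n => // n _.
rewrite {1}/qcatalan /= nth_rcons size_qcatalan_seq ltnn eqxx.
apply: eq_bigr => k _; have le_kn : (k <= n)%N by rewrite -ltnS.
by rewrite !nth_qcatalan_seq // subn1 subSn //= leq_subr.
Qed.

(* Main.v *)
(** In a fixed-point-free 132-avoiding involution [s] no transposition
    [a < s a] can end before another one starts, since [a < c < s c] with
    [s a < c] would read [s a, s c, c], a 132.  Hence [s] exchanges the two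
    halves of [2m], and is given by a permutation [t] of [m] on the first half
    and [t^-1] on the second; [s] avoids 132 iff [t] does, and
    [coinv s = 2 * coinv t].  A 132-avoiding word of length [n + 1] is
    [L n R] with every letter of [L] above every letter of [R], which is the
    recurrence of [C_n(q)] with [k = size L].  The 213 case follows by
    reverse-complement, i.e. conjugation by the decreasing permutation. *)

Require Import Defs.
From mathcomp Require Import all_boot all_order all_algebra all_fingroup.
From mathcomp Require Import zify.

Set Implicit Arguments.
Unset Strict Implicit.
Unset Printing Implicit Defensive.

Import GRing.Theory.
Local Open Scope ring_scope.

(** * Words of natural numbers: 132-avoidance and coinversions *)

(** The recursion is on the letter playing the 1: [y] plays the 3 and [z] the 2. *)
Fixpoint avoids132_seq (w : seq nat) : bool :=
  if w is x :: w' then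
    avoids132_seq w' && pairwise (fun y z => ~~ (x < z < y)%N) w'
  else true.

Fixpoint coinv_seq (w : seq nat) : nat :=
  if w is x :: w' then (count (ltn x) w' + coinv_seq w')%N else 0%N.

Lemma coinv_seq_cat u v :
  coinv_seq (u ++ v) =
    (coinv_seq u + coinv_seq v + \sum_(x <- u) count (ltn x) v)%N.
Proof.
elim: u => [|x u IHu] /=; first by rewrite big_nil addn0.
by rewrite big_cons IHu count_cat; lia.
Qed.

Lemma coinv_seq_shift c u : coinv_seq (map (addn c) u) = coinv_seq u.
Proof.
elim: u => //= x u ->; congr (_ + _)%N; rewrite count_map.
by apply: eq_count => y /=; rewrite ltn_add2l.
Qed.

Lemma avoids132_seq_shift c u : avoids132_seq (map (addn c) u) = avoids132_seq u.
Proof.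
elim: u => //= x u ->; congr (_ && _); rewrite pairwise_map.
by apply: eq_pairwise => y z /=; rewrite !ltn_add2l.
Qed.

Lemma avoids132_seq_catl u v : avoids132_seq (u ++ v) -> avoids132_seq u.
Proof.
by elim: u => //= x u IHu; rewrite pairwise_cat => /andP[/IHu-> /and3P[]].
Qed.

Lemma avoids132_seq_catr u v : avoids132_seq (u ++ v) -> avoids132_seq v.
Proof. by elim: u => //= x u IHu /andP[/IHu]. Qed.

(** A 132 cannot straddle the two sides: a 1 in [u] with a 2 in [v] contradicts [z < x], and the
    maximum [n] can play neither the 1 nor the 2. *)
Lemma avoids132_seq_max (u : seq nat) n (v : seq nat) :
  {in u & v, forall x z, z < x}%N -> {in u ++ v, forall z, z < n}%N ->
  avoids132_seq u -> avoids132_seq v -> avoids132_seq (u ++ n :: v).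
Proof.
move=> ltvu ltwn avu avv; have ltvn z : z \in v -> (z < n)%N.
  by move=> zv; apply: ltwn; rewrite mem_cat zv orbT.
elim: u ltvu ltwn avu => [|x u IHu] ltvu ltwn /=.
  move=> _; rewrite avv; apply/(pairwiseP 0%N) => i j _ ltj _ /=.
  by rewrite ltnNge (ltnW (ltvn _ (mem_nth 0%N ltj))).
case/andP=> avu pwu; rewrite IHu //=; first last.
- by move=> y yu; apply: ltwn; rewrite inE yu orbT.
- by move=> y z yu; apply: ltvu; rewrite inE yu orbT.
have ltvx z : z \in v -> (z < x)%N by apply: ltvu; rewrite inE eqxx.
rewrite pairwise_cat pwu /=; apply/and3P; split.
- apply/allrelP => y z yu; rewrite inE => /orP[/eqP->|/ltvx]; last by lia.
  by have := ltwn y; rewrite inE mem_cat yu orbT => /(_ isT); lia.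
- by apply/allP => z /ltvx /=; lia.
- apply/(pairwiseP 0%N) => i j _ ltj _ /=.
  by rewrite ltnNge (ltnW (ltvx _ (mem_nth 0%N ltj))).
Qed.

(** Otherwise [x], [n], [z] would form a 132. *)
Lemma avoids132_seq_max_gt (u : seq nat) n (v : seq nat) : avoids132_seq (u ++ n :: v) ->
  {in u & v, forall x z, z < n -> z <= x}%N.
Proof.
elim: u => //= y u IHu /andP[/IHu{}IHu].
rewrite pairwise_cat => /and3P[_ _ /= /andP[/allP h _]] x z.
rewrite inE => /orP[/eqP-> zv ltzn|]; last exact: IHu.
by have := h z zv; rewrite /= ltzn andbT -leqNgt.
Qed.

(** * Decomposition at the maximum and the q-Catalan recurrence *)

Definition Av132 n : seq (seq nat) :=
  [seq w <- permutations (iota 0 n) | avoids132_seq w].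

Lemma mem_Av132 n w :
  (w \in Av132 n) = avoids132_seq w && perm_eq w (iota 0 n).
Proof. by rewrite mem_filter mem_permutations. Qed.

(** Both arguments are meant as words on initial segments; the shift lifts [L] just above the
    letters of [R]. *)
Definition join_max n (L R : seq nat) := map (addn (size R)) L ++ n :: R.

(** Sorting each side gives [sort R ++ sort L], a sorted rearrangement of the interval and hence the
    interval itself; cutting it at [size R] gives both claims. *)
Lemma perm_iota_split (L R : seq nat) :
  {in L & R, forall x z, z < x}%N ->
  perm_eq (L ++ R) (iota 0 (size L + size R)) ->
  perm_eq R (iota 0 (size R)) /\ perm_eq L (iota (size R) (size L)).
Proof.
move=> ltRL permLR.
have sorted_sort s : sorted leq (sort leq s) by apply: sort_sorted leq_total _.
have : sort leq R ++ sort leq L = iota 0 (size R + size L).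
  apply: (sorted_eq leq_trans anti_leq).
  - rewrite (sorted_pairwise leq_trans) pairwise_cat.
    rewrite -!(sorted_pairwise leq_trans) !sorted_sort !andbT.
    by apply/allrelP => z x; rewrite !mem_sort => zR xL; apply/ltnW/ltRL.
  - exact: iota_sorted.
  - rewrite addnC; apply: perm_trans permLR; rewrite perm_catC.
    by apply: perm_cat; rewrite perm_sort.
move/eqP; rewrite iotaD add0n eqseq_cat ?size_sort ?size_iota // => /andP[/eqP<- /eqP<-].
by split; rewrite perm_sym perm_sort.
Qed.

Lemma perm_insert_iota n (L R : seq nat) :
  perm_eq (L ++ n :: R) (iota 0 n.+1) = perm_eq (L ++ R) (iota 0 n).
Proof.
rewrite -[n.+1]addn1 iotaD add0n -[n :: R]/([:: n] ++ R).
by rewrite perm_catCA perm_sym (perm_catC (iota 0 n)) /= perm_cons perm_sym.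
Qed.

(** Both lists are duplicate-free, so it suffices to compare their members; [k] is the position of
    the maximum [n]. *)
Lemma Av132S n : perm_eq (Av132 n.+1)
  [seq join_max n p.1 p.2 | k <- iota 0 n.+1,
                            p <- [seq (L, R) | L <- Av132 k, R <- Av132 (n - k)]].
Proof.
have sizeAv k (w : seq nat) : w \in Av132 k -> size w = k.
  by rewrite mem_Av132 => /andP[_ /perm_size]; rewrite size_iota.
have uniqAv k : uniq (Av132 k) by rewrite filter_uniq ?permutations_uniq.
have ltAv k (w : seq nat) (x : nat) : w \in Av132 k -> x \in w -> (x < k)%N.
  by rewrite mem_Av132 => /andP[_ /perm_mem->]; rewrite mem_iota.
(* The position of [n] recovers [k], so families with different [k] do not overlap. *)
have indexAv (L R : seq nat) : (forall x, x \in L -> x < size L)%N ->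
    size L + size R = n -> index n (join_max n L R) = size L.
  move=> ltL <-; rewrite index_cat ifN ?size_map ?index_head ?addn0 //=.
  by apply/mapP => -[x /ltL]; lia.
apply: uniq_perm; first exact: uniqAv.
  apply: allpairs_uniq_dep; first exact: iota_uniq.
    by move=> k _; apply: allpairs_uniq => // -[? ?] [? ?].
  move=> p p' /allpairsPdep[k [q [kn /allpairsP[[L R] [LA RA ->]] ->]]].
  move=> /allpairsPdep[k' [q' [kn' /allpairsP[[L' R'] [/= LA' RA' ->]] ->]]] /=.
  move: kn kn'; rewrite !mem_iota /= => kn kn' eqLR.
  have [sL sR] := (sizeAv _ _ LA, sizeAv _ _ RA).
  have [sL' sR'] := (sizeAv _ _ LA', sizeAv _ _ RA').
  have : index n (join_max n L R) = index n (join_max n L' R') by rewrite eqLR.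
  rewrite !indexAv ?sL ?sL' ?sR ?sR'; try lia; first last.
  - by move=> x; apply: ltAv.
  - by move=> x; apply: ltAv.
  move=> eqk; move/eqP: eqLR; rewrite /join_max eqseq_cat ?size_map ?sL ?sL' //.
  rewrite eqseq_cons eqxx sR sR' eqk => /andP[/eqP eqL /eqP->].
  by rewrite (inj_map (@addnI _) eqL).
move=> w; rewrite mem_Av132; apply/andP/allpairsPdep.
  case=> avw permw.
  have : n \in w by rewrite (perm_mem permw) mem_iota /= add0n.
  move=> nw; case/splitPr: nw avw permw => L R avw.
  rewrite perm_insert_iota => permLR.
  have szLR := perm_size permLR; rewrite size_cat size_iota in szLR.
  have ltn_n x : x \in L ++ R -> (x < n)%N.
    by rewrite (perm_mem permLR) mem_iota.
  have ltRL : {in L & R, forall x z, z < x}%N.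
    move=> x z xL zR; rewrite ltn_neqAle.
    rewrite (avoids132_seq_max_gt avw) ?ltn_n ?mem_cat ?zR ?orbT // andbT.
    have := iota_uniq 0 n; rewrite -(perm_uniq permLR) cat_uniq.
    case/and3P=> _ /hasPn/(_ z zR) /= + _.
    by apply: contraNneq => ->.
  rewrite -szLR in permLR; have [permR permL] := perm_iota_split ltRL permLR.
  (* The truncated subtraction loses nothing, since every letter of [L] is at least [size R]. *)
  pose L0 := map (subn^~ (size R)) L.
  have defL : L = map (addn (size R)) L0.
    rewrite -map_comp map_id_in // => x /=.
    by rewrite (perm_mem permL) mem_iota => /andP[/subnKC].
  exists (size L), (L0, R); split; first by rewrite mem_iota; lia.
    apply/allpairsP; exists (L0, R); split=> //=; rewrite mem_Av132.
      rewrite -(avoids132_seq_shift (size R)) -defL (avoids132_seq_catl avw).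
      rewrite -[size R]addn0 iotaDl {1}defL in permL.
      by rewrite (perm_map_inj (@addnI _) permL).
    rewrite -szLR addKn permR andbT.
    by have /= /andP[] := avoids132_seq_catr avw.
  by rewrite /join_max /= -defL.
case=> k [q [kn /allpairsP[[L R] [/= LA RA ->]] ->]] /=.
have [sL sR] := (sizeAv _ _ LA, sizeAv _ _ RA).
have ltL := ltAv _ _ _ LA; have ltR := ltAv _ _ _ RA.
move: kn; rewrite mem_iota /= => kn; rewrite /join_max; split.
  apply: avoids132_seq_max.
  - by move=> _ z /mapP[x xL ->] /ltR; lia.
  - move=> z; rewrite mem_cat => /orP[/mapP[x /ltL]|/ltR]; lia.
  - by move: LA; rewrite avoids132_seq_shift mem_Av132 => /andP[].
  - by move: RA; rewrite mem_Av132 => /andP[].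
rewrite perm_insert_iota.
have -> : iota 0 n = iota 0 (size R) ++ iota (size R) (size L).
  by rewrite (_ : n = (size R + size L)%N) ?iotaD // sL sR; lia.
rewrite perm_catC perm_cat //.
  by move: RA; rewrite mem_Av132 => /andP[_]; rewrite sR.
rewrite -[X in iota X _]addn0 iotaDl perm_map //.
by move: LA; rewrite mem_Av132 => /andP[_]; rewrite sL.
Qed.

(** Each letter of [L] has exactly one coinversion across the cut, the one with [n]; this accounts
    for the factor [q^k] of the recurrence. *)
Lemma coinv_seq_join_max n (L R : seq nat) :
  {in L, forall x, size R + x < n}%N -> {in R, forall z, z < size R <= n}%N ->
  coinv_seq (join_max n L R) = (size L + coinv_seq L + coinv_seq R)%N.
Proof.
move=> ltL ltR; rewrite /join_max coinv_seq_cat coinv_seq_shift big_map /=.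
have -> : count (ltn n) R = 0%N.
  by apply/eqP; rewrite -leqn0 leqNgt -has_count; apply/hasPn => z /ltR /=; lia.
suff -> : (\sum_(x <- L) ((size R + x < n) + count (ltn (size R + x)) R)
            = size L)%N by lia.
rewrite -(sum1_size L); apply: eq_big_seq => x /ltL /= ->; congr (1 + _)%N.
by apply/eqP; rewrite -leqn0 leqNgt -has_count; apply/hasPn => z /ltR /=; lia.
Qed.

Lemma sum_Av132 n : \sum_(w <- Av132 n) 'X^(coinv_seq w) = qcatalan n.
Proof.
have [k] := ubnP n; elim: k n => // k IHk [|n] ltnk.
  by rewrite [Av132 0](_ : _ = [:: [::]]) // big_seq1 qcatalan0.
rewrite qcatalan_rec // (perm_big _ (Av132S n)) big_allpairs_dep /=.
rewrite -[0%N :: _]/(index_iota 0 n.+1) big_mkord.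
apply: eq_bigr => -[j ltj] _ /=.
rewrite -!IHk; try lia; rewrite big_allpairs -mulrA mulr_suml mulr_sumr subn1 subSn //=.
have mem k' (w : seq nat) : w \in Av132 k' -> size w = k' /\ {in w, forall x, x < k'}%N.
  rewrite mem_Av132 => /andP[_ pw]; split; first by rewrite (perm_size pw) size_iota.
  by move=> x; rewrite (perm_mem pw) mem_iota.
apply: eq_big_seq => L /mem[szL ltL]; rewrite mulrA mulr_sumr.
apply: eq_big_seq => R /mem[szR ltR].
rewrite coinv_seq_join_max ?szL ?szR ?exprD //.
- by move=> x /ltL; lia.
- by move=> x /ltR; lia.
Qed.

(** * From permutations to words *)

Definition word n (s : 'S_n) : seq nat := [seq val (s i) | i <- enum 'I_n].

Lemma pairwise_ltn_enum n : pairwise (fun i j : 'I_n => (i < j)%N) (enum 'I_n).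
Proof.
rewrite -(pairwise_map val ltn) val_enum_ord.
by rewrite -(sorted_pairwise ltn_trans) iota_ltn_sorted.
Qed.

Section Words.
Variables (n : nat) (f : 'I_n -> nat).
Implicit Type e : seq 'I_n.

(** Stated for any increasing list of indices, not just [enum 'I_n], so that induction on the list
    goes through. *)
Lemma coinv_seq_map e : pairwise (fun i j : 'I_n => (i < j)%N) e ->
  coinv_seq (map f e) = (\sum_(i <- e) \sum_(j <- e) ((i < j) && (f i < f j)))%N.
Proof.
elim: e => [|x e IHe] /=; first by rewrite big_nil.
case/andP=> /allP ltx /IHe ->; rewrite !big_cons ltnn /= add0n; congr (_ + _)%N.
  rewrite count_map -sum1_count big_mkcond /=; apply: eq_big_seq => j /ltx ->.
  by rewrite /=; case: ltnP.
apply: eq_big_seq => i /ltx ltxi; rewrite big_cons.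
by rewrite [X in (X && _)](_ : _ = false) //; apply/negbTE; rewrite -leqNgt ltnW.
Qed.

Lemma pairwise_ordP (r : rel 'I_n) e : pairwise (fun i j : 'I_n => (i < j)%N) e ->
  pairwise r e <-> {in e &, forall i j : 'I_n, (i < j)%N -> r i j}.
Proof.
elim: e => [|x e IHe] //= /andP[/allP ltx /IHe{}IHe]; split.
  case/andP=> /allP rx /IHe re i j; rewrite !inE => /predU1P[->|ie] /predU1P[->|je].
  - by rewrite ltnn.
  - by move=> _; apply: rx.
  - by have := ltx _ ie; lia.
  - exact: re.
move=> re; apply/andP; split.
  by apply/allP => j je; apply: re (ltx _ je); rewrite inE ?eqxx ?je ?orbT.
by apply/IHe => i j ie je; apply: re; rewrite inE ?ie ?je orbT.
Qed.

Lemma avoids132_seq_mapP e : pairwise (fun i j : 'I_n => (i < j)%N) e ->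
  avoids132_seq (map f e) <->
  {in e & & , forall i j k : 'I_n, (i < j < k)%N -> ~~ (f i < f k < f j)%N}.
Proof.
elim: e => [|x e IHe] //= /andP[/allP ltx lte]; have {}IHe := IHe lte.
rewrite pairwise_map; split.
  case/andP=> /IHe ave /(pairwise_ordP _ lte) avx i j k.
  rewrite !inE => /predU1P[->|ie] /predU1P[->|je] /predU1P[->|ke];
    try by [lia | have := ltx _ ie; lia | have := ltx _ je; lia].
  - by case/andP=> _; apply: avx.
  - exact: ave.
move=> ave; apply/andP; split.
  by apply/IHe => i j k ie je ke; apply: ave; rewrite inE ?ie ?je ?ke orbT.
apply/(pairwise_ordP _ lte) => j k je ke ltjk /=.
by apply: ave; rewrite ?inE ?eqxx ?je ?ke ?orbT // (ltx _ je).
Qed.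

End Words.

(** A double sum of truth values can be split by halves and reindexed by a permutation. *)
Lemma coinv_sumE n (s : 'S_n) :
  coinv s = (\sum_(i < n) \sum_(j < n) ((i < j) && (s i < s j)))%N.
Proof.
rewrite /coinv -sum1_card pair_bigA /= big_mkcond /=.
by apply: eq_bigr => -[i j] _; rewrite inE /=; case: (_ && _).
Qed.

Lemma coinv_word n (s : 'S_n) : coinv_seq (word s) = coinv s.
Proof.
rewrite coinv_sumE /word (coinv_seq_map _ (pairwise_ltn_enum n)) big_enum /=.
by apply: eq_bigr => i _; rewrite big_enum.
Qed.

Lemma p132E (i : 'I_3) : val (p132 i) = nth 0%N [:: 0; 2; 1]%N i.
Proof.
have : nth 0%N (one_line p132) i = nth 0%N [:: 1; 3; 2]%N i by rewrite one_line_p132.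
rewrite /one_line (nth_map i) ?size_enum_ord // nth_ord_enum.
by case: i => -[|[|[|]]] //= ?; lia.
Qed.

Lemma avoids_p132P n (s : 'S_n) :
  reflect (forall i j k : 'I_n, (i < j < k)%N -> ~~ (s i < s k < s j)%N)
          (avoids_pattern s p132).
Proof.
apply: (iffP idP) => [avs i j k lt_ijk | avs].
  apply: contra avs => lt_s; apply/existsP.
  (* The default [i] of [nth] is never reached, as [x < 3]. *)
  exists [ffun x : 'I_3 => nth i [:: i; j; k] x]; apply/andP; split.
    apply/forallP => x; apply/forallP => y; apply/implyP; rewrite !ffunE.
    by case: x y => -[|[|[|]]] // ? [[|[|[|]]]] //= ? _; lia.
  apply/forallP => x; apply/forallP => y; apply/eqP; rewrite !ffunE !p132E.
  by case: x y => -[|[|[|]]] // ? [[|[|[|]]]] //= ?; lia.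
apply/existsP => -[m /andP[/forallP inc /forallP ord]].
have incE x y := implyP (forallP (inc x) y).
have ordE x y := eqP (forallP (ord x) y).
pose o k := @inord 2 k.
have := avs (m (o 0%N)) (m (o 1%N)) (m (o 2%N)).
by rewrite !incE ?ordE ?p132E !inordK // => /(_ isT).
Qed.

Lemma nth_word n (s : 'S_n) (i : 'I_n) : nth 0%N (word s) i = s i.
Proof. by rewrite (nth_map i) ?size_enum_ord // nth_ord_enum. Qed.

Lemma word_inj n : injective (@word n).
Proof.
by move=> s t eq_st; apply/permP => i; apply: val_inj; rewrite /= -!nth_word eq_st.
Qed.

Lemma avoids132_word n (s : 'S_n) : avoids132_seq (word s) = avoids_pattern s p132.
Proof.
have mapP := avoids132_seq_mapP (fun i => val (s i)) (pairwise_ltn_enum n).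
apply/idP/avoids_p132P => [/mapP avs i j k|avs].
  by apply: avs; rewrite mem_enum.
by apply/mapP => i j k _ _ _; apply: avs.
Qed.

Lemma perm_word n (s : 'S_n) : perm_eq (word s) (iota 0 n).
Proof.
rewrite -val_enum_ord /word map_comp perm_map //; apply: uniq_perm.
- by rewrite map_inj_uniq ?enum_uniq //; apply: perm_inj.
- exact: enum_uniq.
move=> i; rewrite mem_enum; apply/mapP; exists (s^-1 i)%g.
  by rewrite mem_enum.
by rewrite permKV.
Qed.

Lemma word_surj n w : perm_eq w (iota 0 n) -> exists s : 'S_n, word s = w.
Proof.
move=> pw; have szw : size w = n by rewrite (perm_size pw) size_iota.
have ltw (i : 'I_n) : (nth 0 w i < n)%N.
  by have := mem_nth 0%N (etrans (congr1 _ szw) (ltn_ord i)); rewrite (perm_mem pw) mem_iota.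
pose g i := Ordinal (ltw i).
have g_inj : injective g.
  move=> i j /(congr1 val)/= /eqP; rewrite nth_uniq ?szw //; last first.
    by rewrite (perm_uniq pw) iota_uniq.
  by move/eqP/val_inj.
exists (perm g_inj); rewrite /word.
rewrite (eq_map (g := nth 0%N w \o val)); last by move=> i; rewrite permE.
by rewrite map_comp val_enum_ord -szw map_nth_iota0 // take_size.
Qed.

(** [word] maps the avoiding permutations bijectively onto [Av132 n] and preserves the statistic. *)
Lemma sum_avoids_p132 n :
  \sum_(s : 'S_n | avoids_pattern s p132) 'X^(coinv s) = qcatalan n.
Proof.
rewrite -sum_Av132 -big_filter.
have permW : perm_eq
    [seq word s | s <- [seq s <- index_enum {perm 'I_n} | avoids_pattern s p132]]
    (Av132 n).
  apply: uniq_perm.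
  - by rewrite map_inj_uniq ?filter_uniq ?index_enum_uniq //; apply: word_inj.
  - by rewrite filter_uniq ?permutations_uniq.
  move=> w; rewrite mem_Av132; apply/mapP/andP => [[s]|[avw /word_surj[s defw]]].
    by rewrite mem_filter => /andP[avs _] ->; rewrite avoids132_word perm_word.
  by exists s => //; rewrite mem_filter -avoids132_word defw avw mem_index_enum.
by rewrite -(perm_big _ permW) big_map; apply: eq_bigr => s _; rewrite coinv_word.
Qed.

(** * Fixed-point-free 132-avoiding involutions exchange the two halves *)

Section HalfSwap.
Variable m : nat.
Implicit Types (t : 'S_m) (s : 'S_(m + m)).

(** The size is written [m + m] so that [split], [lshift] and [rshift] give access to the halves. *)
Definition half_swap_fun t (x : 'I_(m + m)) : 'I_(m + m) :=
  match split x with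
  | inl i => rshift m (t i)
  | inr j => lshift m (t^-1 j)%g
  end.

Lemma half_swap_fun_lshift t i : half_swap_fun t (lshift m i) = rshift m (t i).
Proof. by rewrite /half_swap_fun (unsplitK (inl i)). Qed.

Lemma half_swap_fun_rshift t j : half_swap_fun t (rshift m j) = lshift m (t^-1 j)%g.
Proof. by rewrite /half_swap_fun (unsplitK (inr j)). Qed.

Lemma half_swap_funK t : involutive (half_swap_fun t).
Proof.
move=> x; case: (split_ordP x) => i ->.
  by rewrite half_swap_fun_lshift half_swap_fun_rshift permK.
by rewrite half_swap_fun_rshift half_swap_fun_lshift permKV.
Qed.

Definition half_swap t : 'S_(m + m) := perm (inv_inj (half_swap_funK t)).

Lemma half_swap_lshift t i : half_swap t (lshift m i) = rshift m (t i).
Proof. by rewrite permE half_swap_fun_lshift. Qed.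

Lemma half_swap_rshift t j : half_swap t (rshift m j) = lshift m (t^-1 j)%g.
Proof. by rewrite permE half_swap_fun_rshift. Qed.

Lemma half_swap_inj : injective half_swap.
Proof.
move=> t u eq_tu; apply/permP => i; apply: (@rshift_inj m).
by rewrite -!half_swap_lshift eq_tu.
Qed.

(** The pattern 132 is its own inverse: an occurrence of it in [t^-1] at [i < j < k] is one in [t]
    at the positions [t^-1 i], [t^-1 k], [t^-1 j]. *)
Lemma avoids_p132V t : avoids_pattern t p132 -> avoids_pattern t^-1%g p132.
Proof.
move=> /avoids_p132P avt; apply/avoids_p132P => i j k lt_ijk.
apply: contraL lt_ijk => /avt; rewrite !permKV; lia.
Qed.

(** Substituting [t i] and [t j] for the indices exchanges the condition on positions with the one
    on values. *)
Lemma coinvV n (t : 'S_n) : coinv t^-1%g = coinv t.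
Proof.
rewrite !coinv_sumE (reindex_inj (@perm_inj _ t)); apply: eq_bigr => i _.
rewrite (reindex_inj (@perm_inj _ t)); apply: eq_bigr => j _.
by rewrite !permK andbC.
Qed.

(** The two halves contribute [coinv t] and [coinv t^-1]. A pair across them contributes nothing,
    because the first half takes the larger values. *)
Lemma coinv_half_swap t : coinv (half_swap t) = (2 * coinv t)%N.
Proof.
rewrite coinv_sumE big_split_ord /= mul2n -addnn; congr (_ + _)%N.
  rewrite coinv_sumE; apply: eq_bigr => i _; rewrite big_split_ord /=.
  rewrite [X in (_ + X)%N]big1 ?addn0 => [|j _].
    by apply: eq_bigr => j _; rewrite !half_swap_lshift /= ltn_add2l.
  by rewrite half_swap_lshift half_swap_rshift /=; have := ltn_ord (t^-1 j)%g; lia.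
rewrite -coinvV coinv_sumE; apply: eq_bigr => i _; rewrite big_split_ord /=.
rewrite big1 => [|j _]; last by have := ltn_ord j; lia.
by apply: eq_bigr => j _; rewrite !half_swap_rshift /= ltn_add2l.
Qed.

Lemma half_swap_FI t : avoids_pattern t p132 -> half_swap t \in FI (m + m) p132.
Proof.
move=> avt; rewrite inE; apply/and3P; split.
- by apply/eqP/permP => x; rewrite permM perm1 !permE half_swap_funK.
- apply/forallP => x; case: (split_ordP x) => i ->.
    by rewrite half_swap_lshift -val_eqE /=; have := ltn_ord i; lia.
  by rewrite half_swap_rshift -val_eqE /=; have := ltn_ord (t^-1 i)%g; lia.
have /avoids_p132P avV := avoids_p132V avt; move/avoids_p132P: avt => avt.
apply/avoids_p132P => x y z.
(* With all three positions in one half this is avoidance by [t] or [t^-1]. In the mixed cases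
   either the positions are out of order, or [x] lies in the first half and [z] in the second, so
   the value at [x] exceeds the one at [z]. *)
case: (split_ordP x) => i ->; case: (split_ordP y) => j ->;
case: (split_ordP z) => k ->; rewrite ?half_swap_lshift ?half_swap_rshift /= ?ltn_add2l;
  try solve [exact: avt | exact: avV].
all: have := ltn_ord i; have := ltn_ord j; have := ltn_ord k.
all: have := ltn_ord (t^-1 i)%g; have := ltn_ord (t^-1 j)%g; have := ltn_ord (t^-1 k)%g.
all: lia.
Qed.

Lemma FI_first_half_gt s : s \in FI (m + m) p132 -> forall i : 'I_m, (m <= s (lshift m i))%N.
Proof.
rewrite inE => /and3P[/eqP ss1 /forallP fpf /avoids_p132P avs].
have sK x : s (s x) = x by rewrite -permM ss1 perm1.
have sNx x : (s x : nat) <> x by move/val_inj/eqP; apply/negP.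
(* If [y < x], the positions [s y < x < s x] carry the values [y], [s x], [x], a 132. *)
have open_lt_close (x y : 'I_(m + m)) : (x < s x)%N -> (s y < y)%N -> (x < y)%N.
  move=> ltx lty; have := avs (s y) x (s x); rewrite !sK.
  have neq_yx : y != x by apply: contraTneq ltx => <-; rewrite -leqNgt ltnW.
  have neq_val : (y : nat) != x by [].
  lia.
(* If [i] closes, so does every [j >= i], and [s] maps these into [0, i). *)
have open_low (i : 'I_(m + m)) : (i < m)%N -> (i < s i)%N.
  move=> lt_im; rewrite ltnNge leq_eqVlt; apply/negP => /orP[/eqP/sNx//|lt_si].
  have closeP (j : 'I_(m + m)) : (i <= j)%N -> (s j < i)%N.
    move=> le_ij; apply: (open_lt_close) => //; rewrite sK.
    case: (ltngtP j (s j)) => // [ltj|/esym/sNx//].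
    by have := open_lt_close _ _ ltj lt_si; lia.
  pose A := [set j : 'I_(m + m) | (i <= j)%N].
  have : s @: A \subset ~: A.
    by apply/subsetP => _ /imsetP[j + ->]; rewrite !inE -ltnNge => /closeP.
  move/subset_leq_card; rewrite (card_imset _ (@perm_inj _ s)).
  have cardC : (#|~: A| <= i)%N.
    have /subset_leq_card : ~: A \subset
        [set widen_ord (ltnW (ltn_ord i)) j | j : 'I_i].
      apply/subsetP => j; rewrite !inE -ltnNge => lt_ji.
      by apply/imsetP; exists (Ordinal lt_ji) => //; apply: val_inj.
    by move/leq_trans; apply; rewrite (leq_trans (leq_imset_card _ _)) // card_ord.
  (* The set [A] and its complement both have at most [i] elements, so [m + m <= i + i], against
     [i < m]. *)
  move=> leA; have := leq_add (leq_trans leA cardC) cardC.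
  by rewrite cardsC card_ord; lia.
move=> i; rewrite leqNgt; apply/negP => lt_sm.
(* If [i] and [s i] both lay in the first half, then [i < s i] and [s i < s (s i) = i]. *)
have := open_low _ lt_sm; have := open_low (lshift m i) (ltn_ord i).
by rewrite sK; lia.
Qed.

(** For the converse inclusion, [t] is read off from the first half of [s]; being an involution, [s]
    is then determined on the second half. *)
Lemma FI_half_swap : FI (m + m) p132 = half_swap @: [set t | avoids_pattern t p132].
Proof.
apply/setP => s; apply/idP/imsetP => [sFI | [t + ->]]; last first.
  by rewrite inE => /half_swap_FI.
have half := FI_first_half_gt sFI.
move: sFI; rewrite inE => /and3P[/eqP ss1 _ /avoids_p132P avs].
have sK x : s (s x) = x by rewrite -permM ss1 perm1.
pose g i := if split (s (lshift m i)) is inr j then j else i.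
have gE i : s (lshift m i) = rshift m (g i).
  rewrite /g; have := half i; case: (split_ordP (s (lshift m i))) => j -> //=.
  by have := ltn_ord j; lia.
have g_inj : injective g.
  move=> i j eq_g; apply: (@lshift_inj m m); apply: (@perm_inj _ s).
  by rewrite !gE eq_g.
exists (perm g_inj).
  rewrite inE; apply/avoids_p132P => i j k lt_ijk.
  have := avs (lshift m i) (lshift m j) (lshift m k) lt_ijk.
  by rewrite !gE /= !ltn_add2l !permE.
apply/permP => x; case: (split_ordP x) => i ->.
  by rewrite half_swap_lshift gE permE.
rewrite half_swap_rshift -[in LHS](permKV (perm g_inj) i) [in LHS]permE.
by rewrite -gE sK.
Qed.

(** [half_swap] is injective and doubles [coinv], which amounts to substituting [q^2] for [q]. *)
Lemma sum_FI132 : \sum_(s in FI (m + m) p132) 'X^(coinv s) = qcatalan m \Po 'X^2.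
Proof.
rewrite FI_half_swap (big_imset _ (in2W half_swap_inj)) /= -sum_avoids_p132.
rewrite rmorph_sum; apply: eq_big => [t|t _]; first by rewrite inE.
by rewrite /= coinv_half_swap exprM comp_Xn_poly.
Qed.
End HalfSwap.

(** * Reverse-complement and the pattern 213 *)

Definition rev_perm n : 'S_n := perm (@rev_ord_inj n).

Lemma rev_permE n i : rev_perm n i = rev_ord i.
Proof. exact: permE. Qed.

Lemma rev_permV n : (rev_perm n)^-1%g = rev_perm n.
Proof.
apply: (mulgI (rev_perm n)); rewrite mulgV; apply/permP => i.
by rewrite permM !rev_permE rev_ordK perm1.
Qed.

Lemma conj_rev_permE n (s : 'S_n) i : (s ^ rev_perm n)%g i = rev_ord (s (rev_ord i)).
Proof. by rewrite conjgE rev_permV !permM !rev_permE. Qed.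

Lemma ltn_rev_ord n (i j : 'I_n) : (rev_ord i < rev_ord j)%N = (j < i)%N.
Proof. by rewrite /=; have := ltn_ord i; have := ltn_ord j; lia. Qed.

Lemma conj_rev_permK n : involutive (fun s : 'S_n => s ^ rev_perm n)%g.
Proof. by move=> s; rewrite /= -{2}rev_permV conjgK. Qed.

(** Reversing the embedding on both sides turns every inequality around twice. One implication
    suffices, since the conjugation is an involution. *)
Lemma contains_conj_rev n k (s : 'S_n) (p : 'S_k) :
  contains_pattern (s ^ rev_perm n)%g (p ^ rev_perm k)%g = contains_pattern s p.
Proof.
have impl (s' : 'S_n) (p' : 'S_k) : contains_pattern s' p' ->
    contains_pattern (s' ^ rev_perm n)%g (p' ^ rev_perm k)%g.
  case/existsP=> m /andP[/forallP inc /forallP ord]; apply/existsP.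
  exists [ffun i => rev_ord (m (rev_ord i))]; apply/andP; split.
    apply/forallP => i; apply/forallP => j; rewrite !ffunE ltn_rev_ord.
    by have /forallP/(_ (rev_ord i)) := inc (rev_ord j); rewrite ltn_rev_ord.
  apply/forallP => i; apply/forallP => j.
  rewrite !ffunE !conj_rev_permE !rev_ordK !ltn_rev_ord.
  by have /forallP/(_ (rev_ord i)) := ord (rev_ord j).
by apply/idP/idP => [/impl|/impl //]; rewrite !conj_rev_permK.
Qed.

(** The coinversion [(i, j)] corresponds to [(rev_ord j, rev_ord i)]; the swap of coordinates is the
    exchange of the two sums. *)
Lemma coinv_conj_rev n (s : 'S_n) : coinv (s ^ rev_perm n)%g = coinv s.
Proof.
rewrite !coinv_sumE (reindex_inj (@rev_ord_inj n)) exchange_big /=.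
rewrite (reindex_inj (@rev_ord_inj n)); apply: eq_bigr => i _.
by apply: eq_bigr => j _; rewrite !conj_rev_permE !rev_ordK !ltn_rev_ord.
Qed.

(** Conjugating a transposition relabels its two points, and [rev_ord] sends 1 to 1 and 2 to 0 in
    ['I_3]. *)
Lemma p213_conj_rev : p213 = (p132 ^ rev_perm 3)%g.
Proof.
rewrite /p132 tpermJ tpermC !rev_permE; congr tperm; apply: val_inj => /=.
  by rewrite !inordK.
by rewrite !inordK.
Qed.

Lemma FI_conj_rev n k (p : 'S_k) (s : 'S_n) :
  ((s ^ rev_perm n)%g \in FI n (p ^ rev_perm k)%g) = (s \in FI n p).
Proof.
rewrite !inE /avoids_pattern contains_conj_rev /is_involution -conjMg.
rewrite conjg_eq1; congr [&& _, _ & _].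
apply/forallP/forallP => fpf i.
  by have := fpf (rev_ord i); rewrite conj_rev_permE rev_ordK (inj_eq rev_ord_inj).
by rewrite conj_rev_permE -[X in _ != X]rev_ordK (inj_eq rev_ord_inj).
Qed.

Lemma sum_FI_rev n k (p : 'S_k) :
  \sum_(s in FI n p) 'X^(coinv s) =
    \sum_(s in FI n (p ^ rev_perm k)%g) 'X^(coinv s) :> {poly int}.
Proof.
rewrite [RHS](reindex_inj (inv_inj (@conj_rev_permK n))) /=.
by apply: eq_big => s => [|_]; rewrite ?FI_conj_rev ?coinv_conj_rev.
Qed.

Theorem theorem3p9 (m : nat) :
  \sum_(s in FI (2 * m) p132) 'X^(coinv s) =
    \sum_(s in FI (2 * m) p213) 'X^(coinv s) :> {poly int} /\
  \sum_(s in FI (2 * m) p213) 'X^(coinv s) = qcatalan m \Po 'X^2 :> {poly int}.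
Proof.
rewrite p213_conj_rev -sum_FI_rev; split=> //.
by rewrite mul2n -addnn sum_FI132.
Qed.
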